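(* Let $r \geq 1$, let $\mathbf{n} = (n_1, \dots, n_r)$ be any $r$-tuple of positive integers, and let $d = 2m$ with $m$ a non-negative integer. Then $$\mathrm{Span}_{\mathbb{C}} \{ f_{[\sigma_1, \dots, \sigma_{r-1}]} : (\sigma_1, \dots, \sigma_{r-1}) \in S_m^{r-1} \} = \mathcal{P}_{\mathbb{R}}^{d}(V(\mathbf{n}))^{K(\mathbf{n})}.$$
   Context: $V(\mathbf{n}) = \mathbb{C}^{n_1} \otimes \cdots \otimes \mathbb{C}^{n_r}$ (tensor over $\mathbb{C}$), with the action of $K(\mathbf{n}) = U(n_1) \times \cdots \times U(n_r)$ (product of unitary groups) given by $(u_1,\dots,u_r)\cdot(v_1 \otimes \cdots \otimes v_r) = (u_1 v_1) \otimes \cdots \otimes (u_r v_r)$. $\mathcal{P}_{\mathbb{R}}(V(\mathbf{n}))$ is the algebra of complex-valued polynomial functions on $V(\mathbf{n})$ viewed as a real vector space, $\mathcal{P}_{\mathbb{R}}^{d}(V(\mathbf{n}))$ is its subspace of homogeneous polynomial functions of degree $d$, and $K(\mathbf{n})$ acts by $(g\cdot f)(v) = f(g^{-1}v)$. A superscript $K(\mathbf{n})$ denotes the subspace of $K(\mathbf{n})$-invariant elements. Let $e_1,\dots,e_n$ be the standard basis of $\mathbb{C}^n$. Write a general element of $V(\mathbf{n})$ as $\sum x^{i_1 \cdots i_r} e_{i_1} \otimes \cdots \otimes e_{i_r}$; regard the coordinates $x^{i_1\cdots i_r}$ as degree 1 elements of $\mathcal{P}_{\mathbb{R}}(V(\mathbf{n}))$,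 and let $y_{i_1 \cdots i_r}$ be the complex conjugate of $x^{i_1 \cdots i_r}$. $S_m$ is the symmetric group on $\{1,\dots,m\}$. For $(\sigma_1,\dots,\sigma_{r-1}) \in S_m^{r-1}$, let $[\sigma_1,\dots,\sigma_{r-1}] = \{(\tau\sigma_1\tau^{-1}, \dots, \tau\sigma_{r-1}\tau^{-1}) : \tau \in S_m\}$ be its orbit under simultaneous conjugation, and define $$f_{[\sigma_1, \dots, \sigma_{r-1}]} = \sum \prod_{j=1}^{m} x^{ i^{(j)}_1 i^{(j)}_2 \cdots i^{(j)}_r } \; y_{ i^{(\sigma_1(j))}_{1} \cdots i^{(\sigma_{r-1}(j))}_{r-1} i^{(j)}_{r} },$$ where the sum is over all choices of indices $i^{(j)}_k$ with $1 \leq i^{(j)}_k \leq n_k$ for $1 \leq j \leq m$, $1 \leq k \leq r$. (This depends only on the orbit $[\sigma_1,\dots,\sigma_{r-1}]$.) *)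

(* Defs.v *)
From HB Require Import structures.
From mathcomp Require Import all_boot all_order all_fingroup all_algebra.
From mathcomp Require Import boolp classical_sets reals complex.
From mathcomp.multinomials Require Import mpoly.

Set Implicit Arguments.
Unset Strict Implicit.
Unset Printing Implicit Defensive.

Import Order.TTheory GRing.Theory Num.Theory.

Local Open Scope classical_set_scope.
Local Open Scope ring_scope.

(* The field of complex numbers is R[i] for R : realType. *)

Definition multi_index (r : nat) (n : 'I_r -> nat) : finType :=
  {dffun forall k : 'I_r, 'I_(n k)}.

(* V(n) = C^(n_1) (x) ... (x) C^(n_r), a tensor being given by its coordinates
   x^(i_1 ... i_r) in the basis e_(i_1) (x) ... (x) e_(i_r). *)
Definition tensor (R : realType) (r : nat) (n : 'I_r -> nat) :=
  {ffun multi_index n -> R[i]}.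

Definition pure_tensor (R : realType) (r : nat) (n : 'I_r -> nat)
    (v : forall k : 'I_r, 'cV[R[i]]_(n k)) : tensor R n :=
  [ffun i : multi_index n => \prod_(k < r) v k (i k) 0].

Definition tensor_act (R : realType) (r : nat) (n : 'I_r -> nat)
    (u : forall k : 'I_r, 'M[R[i]]_(n k)) (v : tensor R n) : tensor R n :=
  [ffun i : multi_index n =>
     \sum_(j : multi_index n) (\prod_(k < r) u k (i k) (j k)) * v j].

Lemma tensor_act_pure (R : realType) (r : nat) (n : 'I_r -> nat)
    (u : forall k : 'I_r, 'M[R[i]]_(n k)) (v : forall k : 'I_r, 'cV[R[i]]_(n k)) :
  tensor_act u (pure_tensor v) = pure_tensor (fun k => u k *m v k).
Proof.
apply/ffunP => i; rewrite !ffunE.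
under [RHS]eq_bigr => k _ do rewrite mxE.
pose G k : {ffun 'I_(n k) -> R[i]} := [ffun j => u k (i k) j * v k j 0].
transitivity (\sum_(j : multi_index n) \prod_(k < r) G k (j k)).
  apply: eq_bigr => j _; rewrite ffunE -big_split.
  by apply: eq_bigr => k _; rewrite ffunE.
rewrite (reindex (@dffun_of_fprod _ (fun k => 'I_(n k) : finType))); last first.
  by apply: onW_bij; apply: dffun_of_fprod_bij.
transitivity (\prod_(k < r) \sum_(j < n k) G k j); last first.
  by apply: eq_bigr => k _; apply: eq_bigr => j _; rewrite ffunE.
under [RHS]eq_bigr => k _ do rewrite (big_tag (fun k j => G k j)).
rewrite bigA_distr_big_dep.
apply: etrans (@big_fprod _ 0 1 *%R +%R _ _ (fun k => G k)).
by apply: eq_bigr => g _; apply: eq_bigr => k _;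
   rewrite [dffun_of_fprod _ _]ffunE.
Qed.

(* The underlying set of K(n) = U(n_1) x ... x U(n_r). *)
Definition unitary_product (R : realType) (r : nat) (n : 'I_r -> nat) :
    set (forall k : 'I_r, 'M[R[i]]_(n k)) :=
  [set g | forall k, g k \is unitarymx].

Definition fun_act (R : realType) (r : nat) (n : 'I_r -> nat)
    (g : forall k : 'I_r, 'M[R[i]]_(n k)) (f : tensor R n -> R[i]) :
    tensor R n -> R[i] :=
  fun v => f (tensor_act (fun k => invmx (g k)) v).

Definition invariant_funs (R : realType) (r : nat) (n : 'I_r -> nat) :
    set (tensor R n -> R[i]) :=
  [set f | forall g, unitary_product g -> fun_act g f = f].

(* Coordinates of v in the real vector space underlying V(n): the real and
   imaginary parts of the x^(i_1 ... i_r), embedded in R[i]. *)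
Definition real_coord (R : realType) (r : nat) (n : 'I_r -> nat)
    (v : tensor R n) (k : 'I_#|{: multi_index n + multi_index n}|) : R[i] :=
  match enum_val k with
  | inl i => 'Re (v i)
  | inr i => 'Im (v i)
  end.

Definition homog_poly_funs (R : realType) (r : nat) (n : 'I_r -> nat) (d : nat) :
    set (tensor R n -> R[i]) :=
  [set f | exists2 p : {mpoly R[i][#|{: multi_index n + multi_index n}|]},
     p \is d.-homog & f = fun v => p.@[real_coord v]].

Definition cspan (R : realType) (T : Type) (A : set (T -> R[i])) :
    set (T -> R[i]) :=
  [set f | exists (N : nat) (c : 'I_N -> R[i]) (h : 'I_N -> T -> R[i]),
     (forall a, A (h a)) /\ f = fun v => \sum_(a < N) c a * h a v].

(* The permutation acting in the k-th tensor slot: sigma_k for k < r - 1 and the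
   identity in the last slot. *)
Definition slot_perm (r m : nat) (sigma : {ffun 'I_r.-1 -> 'S_m}) (k : 'I_r) :
    'S_m :=
  if insub (k : nat) is Some k' then sigma k' else 1%g.

Definition f_poly (R : realType) (r : nat) (n : 'I_r -> nat) (m : nat)
    (sigma : {ffun 'I_r.-1 -> 'S_m}) : tensor R n -> R[i] :=
  fun v => \sum_(i : {ffun 'I_m -> multi_index n}) \prod_(j < m)
    (v (i j) *
     (v [ffun k : 'I_r => i (slot_perm sigma k j) k] : R[i])^*).

(* As functions, sigma k ^ tau = tau \o sigma k \o tau^-1, since permutations
   compose from left to right here. *)
Definition conj_orbit (r m : nat) (sigma : {ffun 'I_r.-1 -> 'S_m}) :
    {set {ffun 'I_r.-1 -> 'S_m}} :=
  [set [ffun k => (sigma k ^ tau)%g] | tau : 'S_m].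

Lemma f_poly_orbit (R : realType) (r : nat) (n : 'I_r -> nat) (m : nat)
    (sigma sigma' : {ffun 'I_r.-1 -> 'S_m}) :
  sigma' \in conj_orbit sigma -> @f_poly R r n m sigma' = f_poly sigma.
Proof.
case/imsetP => tau _ ->; apply/funext => v; rewrite /f_poly.
have slotJ k : slot_perm [ffun k => (sigma k ^ tau)%g] k
             = (slot_perm sigma k ^ tau)%g.
  by rewrite /slot_perm; case: insubP => [k' _ _|_]; rewrite ?ffunE ?conj1g.
pose h s (i : {ffun 'I_m -> multi_index n}) : {ffun 'I_m -> multi_index n} :=
  [ffun j => i (s j)].
have hK (s : 'S_m) : cancel (h (s^-1)%g) (h s).
  by move=> i; apply/ffunP => j; rewrite !ffunE permK.
have hVK (s : 'S_m) : cancel (h s) (h (s^-1)%g).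
  by move=> i; apply/ffunP => j; rewrite !ffunE permKV.
rewrite [RHS](reindex (h tau)); last first.
  by apply: onW_bij; exists (h (tau^-1)%g).
apply: eq_bigr => i _; rewrite (reindex_inj (@perm_inj _ tau)).
apply: eq_bigr => j _; rewrite ffunE; congr (_ * (v _)^*).
by apply/ffunP => k; rewrite !ffunE slotJ permJ.
Qed.

(* Main.v *)
Require Import Defs.
From mathcomp Require Import all_boot all_order all_fingroup all_algebra.
From mathcomp Require Import boolp classical_sets reals complex.
From mathcomp Require Import ring.
From mathcomp.multinomials Require Import mpoly.

(* An invariant function is a Hermitian-type form v |-> w(v) C w(v)^t*, where
   w(v) lists the products of m coordinates of v: invariance under scalars of
   modulus 1 forces bidegree (m, m).  Once C is symmetrized under S_m x S_m it
   is determined by the function, by polarization (Ryser's formula) and because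
   x and its conjugate are algebraically independent; hence C commutes with the
   m-th tensor powers of all unitary families.  By the spectral theorem and a
   density argument it commutes with the tensor powers of arbitrary families of
   matrices, which span the commutant of the group S_m^r permuting the slots.
   The double centralizer theorem then puts C in the span of S_m^r, and the form
   of a slot permutation is one of the f_sigma. *)

Set Implicit Arguments.
Unset Strict Implicit.
Unset Printing Implicit Defensive.

Import Order.TTheory GRing.Theory Num.Theory.

Local Open Scope classical_set_scope.
Local Open Scope ring_scope.
Local Open Scope sesquilinear_scope.

(** * Vanishing of polynomials and Ryser's formula *)

Lemma poly_eq0_inj (F : idomainType) (u : nat -> F) (p : {poly F}) :
  injective u -> (forall k, p.[u k] = 0) -> p = 0.
Proof.
move=> u_inj pu0; apply/eqP/negP => /negP p_neq0.
have := @max_poly_roots _ p (map u (iota 0 (size p))) p_neq0.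
rewrite size_map size_iota ltnn map_inj_uniq ?iota_uniq // => H.
suff : false by []. apply: H => //.
by apply/allP => _ /mapP [k _ ->]; rewrite rootE pu0.
Qed.

Lemma poly_eq0_nat (F : numDomainType) (p : {poly F}) :
  (forall k : nat, p.[k%:R] = 0) -> p = 0.
Proof. by apply: poly_eq0_inj => a b /eqP; rewrite eqr_nat => /eqP. Qed.

Lemma poly_eq0_circle (F : numClosedFieldType) (p : {poly F}) :
  (forall z : F, z * z^* = 1 -> p.[z] = 0) -> p = 0.
Proof.
move=> p0.
have nz (k : nat) (s : F) : s ^+ 2 = -1 -> 1 + k%:R * s != 0.
  move=> s2; apply/eqP => e; have : 1 - (k%:R * s) ^+ 2 = 0 :> F.
    have -> : 1 - (k%:R * s) ^+ 2 = (1 + k%:R * s) * (1 - k%:R * s) by ring.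
    by rewrite e mul0r.
  rewrite exprMn s2 mulrN1 opprK => /eqP.
  by rewrite -natrX -(natrD _ 1) pnatr_eq0.
have i2 := @sqrCi F; have Ni2 : (- 'i) ^+ 2 = -1 :> F by rewrite sqrrN.
(* The Cayley transform gives infinitely many points of the unit circle. *)
pose u (k : nat) : F := (1 + k%:R * 'i) / (1 + k%:R * - 'i).
apply: (@poly_eq0_inj _ u) => [a b|k]; last first.
  apply: p0; rewrite /u rmorphM fmorphV !rmorphD !rmorphM !rmorphN !rmorph1.
  rewrite !rmorph_nat /= conjCi opprK mulf_div [X in _ / X]mulrC divff //.
  by rewrite mulf_neq0 ?nz.
move/eqP; rewrite eqr_div ?nz // -subr_eq0.
have -> : (1 + a%:R * 'i) * (1 + b%:R * - 'i) -
   (1 + b%:R * 'i) * (1 + a%:R * - 'i) = (a%:R - b%:R) * (2 * 'i) :> F.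
  by ring.
rewrite !mulf_eq0 pnatr_eq0 /= (negbTE (neq0Ci F)) orbF subr_eq0 eqr_nat.
by move/eqP.
Qed.

(** The right-hand side is the permanent of [a]. The formula serves as polarization: if the columns
    of [a] depend on separate vectors, the inner sum over [B] depends only on the sum of the vectors
    in [B]. *)
Lemma Ryser (F : comPzRingType) (m : nat) (a : 'I_m -> 'I_m -> F) :
  \sum_(B : {set 'I_m}) (-1) ^+ #|~: B| * \prod_j \sum_(j' in B) a j j' =
  \sum_(s : 'S_m) \prod_j a j (s j).
Proof.
transitivity (\sum_(f : {ffun 'I_m -> 'I_m})
    (\prod_j a j (f j)) * \prod_j (j \in codom f)%:R).
  (* By inclusion-exclusion, the signed sum over the sets B that contain the
     image of f vanishes unless f is onto. *)
  transitivity (\sum_(B : {set 'I_m}) \sum_(f : {ffun 'I_m -> 'I_m})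
      (\prod_j a j (f j)) *
      \prod_j (if j \in B then 1 else - (j \notin codom f)%:R)).
    apply: eq_bigr => B _; rewrite bigA_distr_big big_distrr big_mkcond /=.
    apply: eq_bigr => f _; rewrite mulrC.
    case: ifPn => [/ffun_onP fB|fB].
      congr (_ * _); rewrite -prodr_const [LHS]big_mkcond.
      apply: eq_bigr => j _; rewrite inE; case jB: (j \in B) => //=.
      suff -> : j \notin codom f by [].
      by apply/negP => /codomP [j' ej]; rewrite ej fB in jB.
    have [j fj] : exists j, f j \notin B.
      apply/existsP; rewrite -negb_forall; apply: contra fB => /forallP fB.
      by apply/ffun_onP.
    rewrite [X in _ = _ * X](bigD1 (f j)) //= (negbTE fj) codom_f.
    by rewrite /= oppr0 mul0r mulr0.
  rewrite exchange_big; apply: eq_bigr => f _; rewrite -big_distrr /=.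
  congr (_ * _).
  (* Read backwards, the distributive law turns the sum over [B] into a product over j of factors 1
     minus the indicator of [j \notin codom f]. *)
  apply: etrans (esym (@bigA_distr F 0 1 *%R +%R _ (fun=> 1) _)) _.
  apply: eq_bigr => j _.
  by case: (j \in _); rewrite /= ?oppr0 ?addr0 ?subrr.
rewrite (bigID (fun f : {ffun 'I_m -> 'I_m} => injectiveb f)) /=.
rewrite addrC big1 ?add0r => [|f Uf]; last first.
  have [j fj] : exists j, j \notin codom f.
    apply/existsP; rewrite -negb_forall; apply: contra Uf => /forallP fB.
    apply/injectiveP => x y; apply: (@image_injP _ _ f predT) => //.
    by apply/eqP/eq_card => j; rewrite fB.
  by rewrite [X in _ * X](bigD1 j) //= (negbTE fj) mul0r mulr0.
rewrite (reindex (@pval _)) /=; last first.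
  pose in_Sn := insubd (1%g : 'S_m).
  by exists in_Sn => /= f Uf; first apply: val_inj; apply: insubdK.
apply: eq_big => /= [s | s _]; rewrite ?(valP s) //.
rewrite [X in _ * X]big1 ?mulr1 => [|j _]; last first.
  by rewrite -(permKV s j) -pvalE codom_f.
by apply: eq_bigr => j _; rewrite pvalE.
Qed.

(** * The double centralizer theorem for a finite group *)

(** An equivariant map [P] onto the span [S] of [Q] has structure constants in the commutant of [Q],
    so [A] commutes with them. Then [P A = A *m P 1%:M = #|gT|%:R *: A], which places [A] in [S]. *)
Lemma double_centralizer (F : fieldType) (gT : finGroupType) (N : nat)
    (Q : gT -> 'M[F]_N) (A : 'M[F]_N) :
    #|gT|%:R != 0 :> F -> Q 1%g = 1%:M ->
    {morph Q : g h / (g * h)%g >-> g *m h} ->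
    (forall T, (forall g, T *m Q g = Q g *m T) -> A *m T = T *m A) ->
  exists c : gT -> F, A = \sum_g c g *: Q g.
Proof.
move=> nzG Q1 QM AT.
pose X := [tuple Q (enum_val i) | i < #|gT|].
pose S := <<X>>%VS.
have QS g : Q g \in S.
  apply: memv_span; apply/mapP; exists (enum_rank g); rewrite ?mem_enum //.
  by rewrite enum_rankK.
have SQ B g : B \in S -> Q g *m B \in S.
  move/coord_span => ->; rewrite mulmx_sumr memv_suml // => i _.
  by rewrite -scalemxAr memvZ // -tnth_nth tnth_mktuple -QM QS.
(* Averaging makes the projection onto the span of Q a left G-module map. *)
pose P B := \sum_g Q g^-1%g *m projv S (Q g *m B).
have PS B : P B \in S.
  by apply: memv_suml => g _; apply: SQ; apply: memv_proj.
(* [P] is left unnormalized: on [S] it is multiplication by the order of the group. *)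
have P_id B : B \in S -> P B = #|gT|%:R *: B.
  move=> SB; rewrite /P (eq_bigr (fun=> B)) ?sumr_const ?scaler_nat // => g _.
  by rewrite projv_id ?SQ // mulmxA -QM mulVg Q1 mul1mx.
have P_lin : linear P.
  move=> a B D; rewrite /P scaler_sumr -big_split; apply: eq_bigr => g _ /=.
  by rewrite mulmxDr -scalemxAr linearP /= mulmxDr -scalemxAr.
have P0 : P 0 = 0.
  by apply: (@addrI _ (1 *: P 0)); rewrite -P_lin scaler0 !addr0 scale1r.
have P_sum (I : finType) (c : I -> F) (B : I -> 'M[F]_N) :
    P (\sum_i c i *: B i) = \sum_i c i *: P (B i).
  elim/big_rec2: _ => [//|i y1 y2 _ <-]; exact: P_lin.
have PQ g B : P (Q g *m B) = Q g *m P B.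
  rewrite /P mulmx_sumr (reindex_inj (mulIg g^-1%g)) /=; apply: eq_bigr => h _.
  by rewrite invMg invgK QM !mulmxA; congr (_ *m projv S _); rewrite -QM mulgKV.
(* P commutes with left multiplication by B as soon as B commutes with the
   matrices T b d, whose entries are structure constants of P. *)
pose T b d : 'M[F]_N := \matrix_(a, c) P (delta_mx c d) a b.
have mulE B c d : B *m delta_mx c d = \sum_e B e c *: delta_mx e d.
  apply/matrixP => x y; rewrite mxE summxE (bigD1 c) //= big1 => [|e ne]; last first.
    by rewrite mxE (negbTE ne) mulr0.
  rewrite [RHS](bigD1 x) //= [X in _ = _ + X]big1 => [|e ne]; last first.
    by rewrite !mxE eq_sym (negbTE ne) mulr0.
  by rewrite !mxE !eqxx.
have PT B b d : (forall c, P (B *m delta_mx c d) = B *m P (delta_mx c d)) ->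
    T b d *m B = B *m T b d.
  move=> PB; apply/matrixP => a c.
  have := congr1 (fun M : 'M_N => M a b) (PB c).
  rewrite mulE P_sum summxE mxE => e.
  rewrite !mxE; apply: etrans (etrans e _); apply: eq_bigr => x _.
    by rewrite !mxE mulrC.
  by rewrite !mxE.
have PA c d : P (A *m delta_mx c d) = A *m P (delta_mx c d).
  apply/matrixP => a b.
  have /matrixP/(_ a c) := AT (T b d) (fun g => PT (Q g) b d (fun c => PQ g _)).
  rewrite mulE P_sum summxE !mxE => e; apply: esym; apply: etrans (etrans e _).
    by apply: eq_bigr => x _; rewrite !mxE.
  by apply: eq_bigr => x _; rewrite !mxE mulrC.
have AS : A \in S.
  suff e : P A = #|gT|%:R *: A.
    by rewrite -[A](scalerK nzG) -e memvZ.
  have -> : P A = A *m P 1%:M.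
    have P_sum1 (B : 'I_N -> 'M[F]_N) : P (\sum_i B i) = \sum_i P (B i).
      have := P_sum _ (fun=> 1) B.
      by under eq_bigr do rewrite scale1r; under [RHS]eq_bigr do rewrite scale1r.
    rewrite -[in LHS](mulmx1 A) mx1_sum_delta mulmx_sumr !P_sum1 mulmx_sumr.
    by apply: eq_bigr.
  by rewrite -Q1 P_id // -scalemxAr Q1 mulmx1.
exists (fun g => coord X (enum_rank g) A).
rewrite (reindex (@enum_val gT predT)) /=; last exact/onW_bij/enum_val_bij.
rewrite [LHS](coord_span AS); apply: eq_bigr => i _.
by rewrite enum_valK -tnth_nth tnth_mktuple.
Qed.

(** * Tensor powers and slot permutations *)

Section MultiIndexMatrices.

Variables (F : numClosedFieldType) (r : nat) (n : 'I_r -> nat) (m : nat).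

Local Notation M := (multi_index n).
Local Notation X := {ffun 'I_m -> M}.
Local Notation mxfam := (forall k : 'I_r, 'M[F]_(n k)).

Lemma sum_prod_multi_index (G : forall k : 'I_r, 'I_(n k) -> F) :
  \sum_(i : M) \prod_k G k (i k) = \prod_k \sum_(x < n k) G k x.
Proof.
pose G' k : {ffun 'I_(n k) -> F} := [ffun x => G k x].
transitivity (\sum_(i : M) \prod_k G' k (i k)).
  by apply: eq_bigr => i _; apply: eq_bigr => k _; rewrite ffunE.
rewrite (reindex (@dffun_of_fprod _ (fun k => 'I_(n k) : finType))); last first.
  by apply: onW_bij; apply: dffun_of_fprod_bij.
transitivity (\prod_k \sum_(x < n k) G' k x); last first.
  by apply: eq_bigr => k _; apply: eq_bigr => x _; rewrite ffunE.
under [RHS]eq_bigr => k _ do rewrite (big_tag (fun k x => G' k x)).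
rewrite bigA_distr_big_dep.
apply: etrans (@big_fprod _ 0 1 *%R +%R _ _ (fun k => G' k)).
by apply: eq_bigr => g _; apply: eq_bigr => k _; rewrite [dffun_of_fprod _ _]ffunE.
Qed.

(** The natural basis of the m-th tensor power of V is indexed by [X], whereas matrices have ordinal
    indices; [enum_val] passes from one to the other. *)
Definition fun_mx (f : X -> X -> F) : 'M[F]_#|{: X}| :=
  \matrix_(a, b) f (enum_val a) (enum_val b).

Lemma fun_mx_mul (f g : X -> X -> F) :
  fun_mx f *m fun_mx g = fun_mx (fun I J => \sum_K f I K * g K J).
Proof.
apply/matrixP => a b; rewrite !mxE [RHS](reindex (@enum_val X predT)) /=.
  by apply: eq_bigr => c _; rewrite !mxE.
exact/onW_bij/enum_val_bij.
Qed.

Lemma eq_fun_mx (f g : X -> X -> F) : f =2 g -> fun_mx f = fun_mx g.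
Proof. by move=> fg; apply/matrixP => a b; rewrite !mxE. Qed.

(** The Kronecker product of the [A k] over k, raised to its m-th tensor power. *)
Definition tens_pow (A : mxfam) : 'M[F]_#|{: X}| :=
  fun_mx (fun I J => \prod_j \prod_k A k (I j k) (J j k)).

Lemma tens_powM (A B : mxfam) :
  tens_pow A *m tens_pow B = tens_pow (fun k => A k *m B k).
Proof.
rewrite fun_mx_mul; apply: eq_fun_mx => I J /=.
under eq_bigr => K _ do rewrite -big_split /=.
rewrite -(bigA_distr_bigA (fun j (i : M) => \prod_k A k (I j k) (i k) *
   \prod_k B k (i k) (J j k))) /=.
apply: eq_bigr => j _; under eq_bigr => i _ do rewrite -big_split /=.
rewrite (sum_prod_multi_index (fun k x => A k (I j k) x * B k x (J j k))).
by apply: eq_bigr => k _; rewrite mxE.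
Qed.

Lemma prod_eqb (T : finType) (P : pred T) :
  \prod_t (P t)%:R = [forall t, P t]%:R :> F.
Proof.
case: forallP => [PT|/forallP]; first by rewrite big1 // => t _; rewrite PT.
by rewrite negb_forall => /existsP [t /negbTE Pt]; rewrite (bigD1 t) //= Pt mul0r.
Qed.

Lemma multi_eqb (I J : X) :
  (\prod_j \prod_k (I j k == J j k)%:R) = (I == J)%:R :> F.
Proof.
under eq_bigr do rewrite prod_eqb; rewrite prod_eqb; congr (nat_of_bool _)%:R.
apply/forallP/eqP => [IJ|-> j]; last exact/forallP.
by apply/ffunP => j; apply/ffunP => k; apply/eqP/(forallP (IJ j)).
Qed.

Lemma tens_pow_diag (d : forall k, 'rV[F]_(n k)) :
  tens_pow (fun k => diag_mx (d k)) =
  fun_mx (fun I J => (I == J)%:R * \prod_j \prod_k d k 0 (I j k)).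
Proof.
apply: eq_fun_mx => I J /=; rewrite -multi_eqb -big_split; apply: eq_bigr => j _ /=.
by rewrite -big_split; apply: eq_bigr => k _ /=; rewrite mxE mulr_natl.
Qed.

Lemma tens_pow1 : tens_pow (fun k => 1%:M) = 1%:M.
Proof.
apply/matrixP => a b; rewrite !mxE -(inj_eq enum_val_inj) -multi_eqb.
by apply: eq_bigr => j _; apply: eq_bigr => k _; rewrite mxE.
Qed.

Lemma tr_tens_pow (A : mxfam) : (tens_pow A)^T = tens_pow (fun k => (A k)^T).
Proof.
apply/matrixP => a b; rewrite !mxE.
by apply: eq_bigr => j _; apply: eq_bigr => k _; rewrite mxE.
Qed.

Lemma map_tens_pow (A : mxfam) :
  map_mx Num.conj (tens_pow A) = tens_pow (fun k => map_mx Num.conj (A k)).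
Proof.
apply/matrixP => a b; rewrite !mxE rmorph_prod; apply: eq_bigr => j _.
by rewrite rmorph_prod; apply: eq_bigr => k _; rewrite mxE.
Qed.

Local Notation G := {dffun forall k : 'I_r, 'S_m}.

(** The k-th index is permuted across the m factors by [h k], independently for each k.
    Precomposition gives a left action since permutations compose from left to right. *)
Definition slot_act (h : G) (I : X) : X := [ffun j => [ffun k => I (h k j) k]].

Lemma slot_actM (g h : G) I : slot_act g (slot_act h I) = slot_act (g * h)%g I.
Proof. by apply/ffunP => j; apply/ffunP => k; rewrite !ffunE permM. Qed.

Lemma slot_act1 I : slot_act 1%g I = I.
Proof. by apply/ffunP => j; apply/ffunP => k; rewrite !ffunE perm1. Qed.

Lemma slot_actK (h : G) : cancel (slot_act h) (slot_act h^-1%g).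
Proof. by move=> I; rewrite slot_actM mulVg slot_act1. Qed.

Lemma slot_actVK (h : G) : cancel (slot_act h^-1%g) (slot_act h).
Proof. by move=> I; rewrite slot_actM mulgV slot_act1. Qed.

Definition slot_mx (h : G) : 'M[F]_#|{: X}| :=
  fun_mx (fun I J => (I == slot_act h J)%:R).

Lemma mul_fun_slot (f : X -> X -> F) h :
  fun_mx f *m slot_mx h = fun_mx (fun I J => f I (slot_act h J)).
Proof.
rewrite fun_mx_mul; apply: eq_fun_mx => I J /=.
rewrite (bigD1 (slot_act h J)) //= eqxx mulr1 big1 ?addr0 // => K /negbTE ->.
by rewrite mulr0.
Qed.

Lemma mul_slot_fun (f : X -> X -> F) h :
  slot_mx h *m fun_mx f = fun_mx (fun I J => f (slot_act h^-1%g I) J).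
Proof.
rewrite fun_mx_mul; apply: eq_fun_mx => I J /=.
rewrite (bigD1 (slot_act h^-1%g I)) //= slot_actVK eqxx mul1r big1 ?addr0 // => K.
case: (I =P slot_act h K) => [->|_ _]; last by rewrite mul0r.
by rewrite slot_actK eqxx.
Qed.

Lemma slot_mxM : {morph slot_mx : g h / (g * h)%g >-> g *m h}.
Proof.
by move=> g h; rewrite mul_fun_slot; apply: eq_fun_mx => I J /=; rewrite slot_actM.
Qed.

Lemma slot_mx1 : slot_mx 1%g = 1%:M.
Proof.
by apply/matrixP => a b; rewrite !mxE slot_act1 (inj_eq enum_val_inj).
Qed.

Lemma tr_slot_mx h : (slot_mx h)^T = slot_mx h^-1%g.
Proof.
apply/matrixP => a b; rewrite !mxE eq_sym.
by rewrite -(can2_eq (slot_actK h) (slot_actVK h)).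
Qed.

(** For each k the same matrix [A k] acts in all m factors, so the product over j can be reindexed
    by [h k] separately in each slot. *)
Lemma tens_pow_slot (A : mxfam) h :
  tens_pow A *m slot_mx h = slot_mx h *m tens_pow A.
Proof.
rewrite mul_fun_slot mul_slot_fun; apply: eq_fun_mx => I J /=.
rewrite exchange_big [RHS]exchange_big; apply: eq_bigr => k _.
rewrite [RHS](reindex_inj (@perm_inj _ (h k))); apply: eq_bigr => j _.
by rewrite !ffunE permK.
Qed.

(* Ryser's formula in each of the r slots writes the orbit sum of a matrix unit
   through tensor powers of families A B, hence by polarization the commutant
   of the slot permutations is spanned by tensor powers. *)
Lemma slot_orbit_sum (I0 J0 : X) :
  exists e A, \sum_h slot_mx h *m delta_mx (enum_rank I0) (enum_rank J0) *m
    slot_mx h^-1%g = \sum_(B : {ffun 'I_r -> {set 'I_m}}) e B *: tens_pow (A B).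
Proof.
exists (fun B : {ffun 'I_r -> {set 'I_m}} => \prod_k (-1) ^+ #|~: B k|).
(* In slot k this is the sum, over j in [B k], of the matrix units at [(I0 j k, J0 j k)]. *)
exists (fun (B : {ffun 'I_r -> {set 'I_m}}) k => \matrix_(x, y) \sum_(j in B k)
  (x == I0 j k)%:R * (y == J0 j k)%:R).
apply/matrixP => a b; rewrite !summxE.
set I := enum_val a; set J := enum_val b.
pose c k j j' : F := (I j k == I0 j' k)%:R * (J j k == J0 j' k)%:R.
transitivity (\sum_(h : G) \prod_k \prod_j c k j (h k j)).
  apply: eq_bigr => h _.
  have -> : delta_mx (enum_rank I0) (enum_rank J0) =
      fun_mx (fun I J => (I == I0)%:R * (J == J0)%:R).
    apply/matrixP => x y; rewrite !mxE -(inj_eq enum_val_inj).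
    by rewrite -(inj_eq enum_val_inj y) !enum_rankK -natrM mulnb.
  rewrite mul_slot_fun mul_fun_slot mxE -/I -/J.
  rewrite !(can2_eq (slot_actVK h) (slot_actK h)).
  rewrite -!multi_eqb exchange_big [X in _ * X]exchange_big -big_split.
  apply: eq_bigr => k _; rewrite -big_split; apply: eq_bigr => j _.
  by rewrite /c !ffunE.
(* The sum over [h] factors into a product over the slots k of the permanents of [c k]. *)
rewrite -(bigA_distr_bigA (fun k (s : 'S_m) => \prod_j c k j (s j))).
under eq_bigr do rewrite -Ryser.
rewrite bigA_distr_bigA; apply: eq_bigr => B _; rewrite !mxE big_split /=.
congr (_ * _); rewrite [RHS]exchange_big; apply: eq_bigr => k _.
by apply: eq_bigr => j _; rewrite mxE.
Qed.

(** A matrix [T] in the commutant of the slot permutations is its own average over the group.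
    Expanded in matrix units, it is a combination of orbit sums, hence of tensor powers by
    [slot_orbit_sum]. *)
Lemma commute_tens_pow_slot (C : 'M[F]_#|{: X}|) :
    (forall A, C *m tens_pow A = tens_pow A *m C) ->
  forall T, (forall g, T *m slot_mx g = slot_mx g *m T) -> C *m T = T *m C.
Proof.
move=> CA T TQ.
have nzG : #|G|%:R != 0 :> F.
  by rewrite pnatr_eq0 -lt0n; apply/card_gt0P; exists 1%g.
have eT : #|G|%:R *: T = \sum_a \sum_b T a b *:
    (\sum_h slot_mx h *m delta_mx a b *m slot_mx h^-1%g).
  transitivity (\sum_h slot_mx h *m T *m slot_mx h^-1%g).
    rewrite (eq_bigr (fun=> T)) ?sumr_const ?scaler_nat // => h _.
    by rewrite -TQ -mulmxA -slot_mxM mulgV slot_mx1 mulmx1.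
  under [RHS]eq_bigr do under eq_bigr do rewrite scaler_sumr.
  under [RHS]eq_bigr do rewrite exchange_big.
  rewrite [RHS]exchange_big; apply: eq_bigr => h _ /=.
  rewrite [in LHS](matrix_sum_delta T) mulmx_sumr mulmx_suml.
  apply: eq_bigr => a _; rewrite mulmx_sumr mulmx_suml; apply: eq_bigr => b _.
  by rewrite -scalemxAr -scalemxAl.
apply: (scalerI nzG); rewrite scalemxAr scalemxAl eT mulmx_sumr mulmx_suml.
apply: eq_bigr => a _; rewrite mulmx_sumr mulmx_suml; apply: eq_bigr => b _.
rewrite -scalemxAr -scalemxAl; congr (_ *: _).
have [e [A]] := slot_orbit_sum (enum_val a) (enum_val b).
rewrite !enum_valK => ->; rewrite mulmx_sumr mulmx_suml; apply: eq_bigr => B _.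
by rewrite -scalemxAr -scalemxAl CA.
Qed.

End MultiIndexMatrices.

(** * From unitary families to arbitrary families of matrices *)

Section UnitaryDensity.

Variables (F : numClosedFieldType) (r : nat) (n : 'I_r -> nat) (m : nat).

Local Notation X := {ffun 'I_m -> multi_index n}.
Local Notation mxfam := (forall k : 'I_r, 'M[F]_(n k)).

Variable C : 'M[F]_#|{: X}|.
Hypothesis C_unitary : forall u : mxfam, (forall k, u k \is unitarymx) ->
  C *m tens_pow m u = tens_pow m u *m C.

(* Testing C against diagonal unitary matrices: a nonzero entry joins indices of
   equal weight, because their characters of the torus agree. *)
Lemma weight_unitary a b k x : C a b != 0 ->
  #|[pred j | enum_val a j k == x]| = #|[pred j | enum_val b j k == x]|.
Proof.
move=> Cab; set w := fun a : 'I_#|{: X}| => #|[pred j | enum_val a j k == x]|.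
(* A torus element with z at position [x] of slot [k] and 1 elsewhere. Positions are compared in
   [nat] because [y] and [x] live in different ordinal types. *)
pose d (z : F) l : 'rV[F]_(n l) :=
  \row_y (if (l == k) && (y == x :> nat) then z else 1).
have prod_d z (c : 'I_#|{: X}|) :
    \prod_j \prod_l d z l 0 (enum_val c j l) = z ^+ w c.
  rewrite exchange_big (bigD1 k) //= [X in _ * X]big1 ?mulr1 => [|l /negbTE lk].
    rewrite /w -prodr_const [RHS]big_mkcond; apply: eq_bigr => j _.
    by rewrite mxE eqxx.
  by rewrite big1 // => j _; rewrite mxE lk.
have : 'X^(w a) - 'X^(w b) = 0 :> {poly F}.
  apply: poly_eq0_circle => z zz; rewrite !hornerE.
  have ud l : diag_mx (d z l) \is unitarymx.
    apply/unitarymxP/matrixP => y y'.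
    rewrite tr_diag_mx map_diag_mx mulmx_diag !mxE.
    by case: ifP => _; rewrite ?zz // rmorph1 mulr1.
  have /matrixP/(_ a b) := C_unitary ud.
  rewrite tens_pow_diag !mxE (bigD1 b) //= big1 => [|c cb]; last first.
    by rewrite mxE (inj_eq enum_val_inj) (negbTE cb) mul0r mulr0.
  rewrite [RHS](bigD1 a) //= [X in _ = _ + X]big1 => [|c ca]; last first.
    by rewrite mxE (inj_eq enum_val_inj) eq_sym (negbTE ca) !mul0r.
  rewrite !addr0 !mxE !eqxx !mul1r !prod_d mulrC => /(mulIf Cab) ->.
  by rewrite subrr.
move/eqP; rewrite subr_eq0 => /eqP /(congr1 (fun p : {poly F} => size p)).
by rewrite !size_polyXn => -[].
Qed.

(** A diagonal tensor power depends on an index only through its weights, which agree wherever [C]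
    has a nonzero entry. *)
Lemma commute_diag (d : forall k, 'rV[F]_(n k)) :
  C *m tens_pow m (fun k => diag_mx (d k)) =
  tens_pow m (fun k => diag_mx (d k)) *m C.
Proof.
rewrite tens_pow_diag; apply/matrixP => a b.
rewrite !mxE (bigD1 b) //= big1 => [|c cb]; last first.
  by rewrite mxE (inj_eq enum_val_inj) (negbTE cb) mul0r mulr0.
rewrite [RHS](bigD1 a) //= [X in _ = _ + X]big1 => [|c ca]; last first.
  by rewrite mxE (inj_eq enum_val_inj) eq_sym (negbTE ca) !mul0r.
rewrite !addr0 !mxE !eqxx !mul1r mulrC.
have [->|Cab] := eqVneq (C a b) 0; first by rewrite !mulr0.
congr (_ * _); rewrite exchange_big [RHS]exchange_big; apply: eq_bigr => k _ /=.
have prod_d (c : 'I_#|{: X}|) : \prod_j d k 0 (enum_val c j k) =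
    \prod_x d k 0 x ^+ #|[pred j | enum_val c j k == x]|.
  rewrite (partition_big (fun j => enum_val c j k) xpredT) //=.
  apply: eq_bigr => x _; rewrite -prodr_const.
  by apply: eq_bigr => j /eqP ->.
by rewrite !prod_d; apply: eq_bigr => x _; rewrite (weight_unitary x Cab).
Qed.

Lemma commute_normal (H : mxfam) : (forall k, H k \is normalmx) ->
  C *m tens_pow m H = tens_pow m H *m C.
Proof.
move=> nH.
have eH : tens_pow m H = tens_pow m (fun k => invmx (spectralmx (H k))) *m
    tens_pow m (fun k => diag_mx (spectral_diag (H k))) *m
    tens_pow m (fun k => spectralmx (H k)).
  rewrite !tens_powM; congr (tens_pow m _).
  by apply/functional_extensionality_dep => k; exact/orthomx_spectralP.
rewrite eH !mulmxA C_unitary => [|k]; last first.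
  by rewrite invmx_unitary ?trmxC_unitary ?spectral_unitarymx.
rewrite -(mulmxA _ C) commute_diag -!mulmxA; congr (_ *m (_ *m _)).
by apply: C_unitary => k; exact: spectral_unitarymx.
Qed.

(* A = H + 'i K with H and K Hermitian, and H + t K is Hermitian for real t; a
   polynomial in t vanishing on the naturals vanishes at 'i. *)
Lemma commute_tens_pow (A : mxfam) :
  C *m tens_pow m A = tens_pow m A *m C.
Proof.
pose H k : 'M[F]_(n k) := 2^-1 *: (A k + (A k)^t*).
pose K k : 'M[F]_(n k) := (2 * 'i)^-1 *: (A k - (A k)^t*).
have herm k (t : nat) : H k + t%:R *: K k \is normalmx.
  apply/normalmxP; suff -> : (H k + t%:R *: K k)^t* = H k + t%:R *: K k by [].
  apply/matrixP => x y; rewrite !mxE !rmorphD !rmorphM !fmorphV !rmorphM.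
  rewrite !rmorphD !rmorphN /= !conjCK !rmorph_nat conjCi rmorph1.
  by rewrite mulrN invrN mulNr -mulrN opprB [_ + A k x y]addrC.
have eA : A = fun k => H k + 'i *: K k.
  apply/functional_extensionality_dep => k; rewrite /H /K scalerA.
  rewrite invfM mulrCA divff ?neq0Ci // mulr1 -scalerDr addrACA subrr addr0.
  by rewrite -mulr2n -scaler_nat scalerA mulVf ?scale1r // pnatr_eq0.
pose P (a b : 'I_#|{: X}|) : {poly F} := \prod_j \prod_k
  ((H k (enum_val a j k) (enum_val b j k))%:P +
   'X * (K k (enum_val a j k) (enum_val b j k))%:P).
have PE t a b : (P a b).[t] = tens_pow m (fun k => H k + t *: K k) a b.
  rewrite mxE !horner_prod; apply: eq_bigr => j _; rewrite horner_prod.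
  by apply: eq_bigr => k _; rewrite !hornerE !mxE.
rewrite eA; apply/matrixP => a b; apply/eqP; rewrite -subr_eq0 !mxE; apply/eqP.
pose p := \sum_c (C a c)%:P * P c b - \sum_c P a c * (C c b)%:P.
have pE t : p.[t] = (C *m tens_pow m (fun k => H k + t *: K k)) a b -
    (tens_pow m (fun k => H k + t *: K k) *m C) a b.
  rewrite !mxE hornerD hornerN !horner_sum.
  congr (_ - _); apply: eq_bigr => c _; rewrite hornerM hornerC PE //.
suff p0 : p = 0 by have := pE 'i; rewrite p0 horner0 !mxE.
apply: poly_eq0_nat => t; rewrite pE commute_normal ?subrr // => k; exact: herm.
Qed.

End UnitaryDensity.

(** * Forms attached to matrices *)

Section Forms.

Variables (F : numClosedFieldType) (r : nat) (n : 'I_r -> nat) (m : nat).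

Local Notation M := (multi_index n).
Local Notation X := {ffun 'I_m -> M}.
Local Notation G := {dffun forall k : 'I_r, 'S_m}.
Local Notation mxfam := (forall k : 'I_r, 'M[F]_(n k)).

(** The coordinates of the m-th tensor power of the vector [v]. *)
Definition mon_row (v : {ffun M -> F}) : 'rV[F]_#|{: X}| :=
  \row_(a < #|{: X}|) \prod_j v (enum_val a j).

Definition form (C : 'M[F]_#|{: X}|) (v : {ffun M -> F}) : F :=
  (mon_row v *m C *m (mon_row v)^t*) 0 0.

(** The diagonal embedding of S_m in S_m^r; it permutes whole tensor factors. *)
Definition const_perm (s : 'S_m) : G := [ffun=> s].

(** The projector onto symmetric tensors. *)
Definition sym_mx : 'M[F]_#|{: X}| :=
  (m`!)%:R^-1 *: \sum_s slot_mx F n (const_perm s).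

Lemma mon_row_mul_slot v h : mon_row v *m slot_mx F n h =
  \row_(b < #|{: X}|) \prod_j v (slot_act h (enum_val b) j).
Proof.
apply/rowP => b; rewrite !mxE.
rewrite (bigD1 (enum_rank (slot_act h (enum_val b)))) //= big1 => [|a ab].
  by rewrite !mxE enum_rankK eqxx mulr1 addr0.
rewrite !mxE; case: eqP => [e|]; last by rewrite mulr0.
by rewrite -e enum_valK eqxx in ab.
Qed.

Lemma mon_row_slot v s : mon_row v *m slot_mx F n (const_perm s) = mon_row v.
Proof.
rewrite mon_row_mul_slot; apply/rowP => b; rewrite !mxE.
rewrite [RHS](reindex_inj (@perm_inj _ s)); apply: eq_bigr => j _; congr (v _).
by apply/ffunP => k; rewrite !ffunE.
Qed.

Lemma fact_neq0 : (m`!)%:R != 0 :> F.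
Proof. by rewrite pnatr_eq0 -lt0n fact_gt0. Qed.

Lemma mon_row_sym v : mon_row v *m sym_mx = mon_row v.
Proof.
rewrite -scalemxAr mulmx_sumr (eq_bigr _ (fun s _ => mon_row_slot v s)).
by rewrite sumr_const card_Sn -scaler_nat scalerA mulVf ?scale1r ?fact_neq0.
Qed.

Lemma tr_sym_mx : sym_mx^T = sym_mx.
Proof.
rewrite /sym_mx linearZ linear_sum /= (reindex_inj invg_inj); congr (_ *: _).
apply: eq_bigr => s _; rewrite tr_slot_mx; congr slot_mx.
by apply/ffunP => k; rewrite !ffunE invgK.
Qed.

Lemma sym_mxK : sym_mx *m sym_mx = sym_mx.
Proof.
rewrite {2}/sym_mx -scalemxAr mulmx_sumr.
rewrite (eq_bigr (fun=> sym_mx)) => [|s _].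
  by rewrite sumr_const card_Sn -scaler_nat scalerA mulVf ?scale1r ?fact_neq0.
rewrite -scalemxAl mulmx_suml [in RHS]/sym_mx (reindex_inj (mulIg s^-1%g)).
congr (_ *: _); apply: eq_bigr => t _; rewrite -slot_mxM; congr slot_mx.
by apply/ffunP => k; rewrite !ffunE mulgKV.
Qed.

Lemma tens_pow_sym (A : mxfam) :
  tens_pow m A *m sym_mx = sym_mx *m tens_pow m A.
Proof.
rewrite -scalemxAr -scalemxAl mulmx_sumr mulmx_suml; congr (_ *: _).
by apply: eq_bigr => s _; rewrite tens_pow_slot.
Qed.

(** Polarization: by Ryser's formula a symmetrized basis tensor is a signed combination of m-th
    powers of the sums of its factors over subsets [B]. *)
Lemma col_sym_mx (b : 'I_#|{: X}|) : exists (e : {set 'I_m} -> F) x,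
  col b sym_mx = \sum_B e B *: (mon_row (x B))^T.
Proof.
exists (fun B => (m`!)%:R^-1 * (-1) ^+ #|~: B|).
exists (fun B : {set 'I_m} => [ffun i => \sum_(j in B) (i == enum_val b j)%:R]).
apply/colP => a; rewrite !mxE !summxE.
under [RHS]eq_bigr do rewrite !mxE -mulrA.
rewrite -mulr_sumr; congr (_ * _).
under [RHS]eq_bigr => B _ do under eq_bigr do rewrite ffunE.
rewrite Ryser; apply: eq_bigr => s _; rewrite prod_eqb mxE.
congr (nat_of_bool _)%:R.
apply/eqP/forallP => [->|ab].
  by move=> j; apply/eqP/ffunP => k; rewrite !ffunE.
by apply/ffunP => j; rewrite (eqP (ab j)); apply/ffunP => k; rewrite !ffunE.
Qed.

Lemma sym_mx_eq0 C :
  (forall x y, mon_row x *m C *m (mon_row y)^T = 0) -> sym_mx *m C *m sym_mx = 0.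
Proof.
move=> C0; apply/matrixP => a b.
have -> : (sym_mx *m C *m sym_mx) a b = ((col a sym_mx)^T *m C *m col b sym_mx) 0 0.
  by rewrite tr_col tr_sym_mx -row_mul colE mulmxA -row_mul -colE [RHS]mxE [RHS]mxE.
have [e [x ->]] := col_sym_mx a; have [e' [x' ->]] := col_sym_mx b.
rewrite [(\sum_B _)^T]linear_sum /= !mulmx_suml summxE big1 ?mxE // => B _.
rewrite mulmx_sumr summxE big1 // => B' _.
by rewrite [(_ *: _)^T]linearZ /= trmxK -!scalemxAl -scalemxAr C0 !scaler0 mxE.
Qed.

Lemma tr_conj_mon_row v : (mon_row v)^t* = (mon_row [ffun i => (v i)^*])^T.
Proof.
apply/matrixP => a b; rewrite !mxE rmorph_prod.
by apply: eq_bigr => j _; rewrite ffunE.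
Qed.

Lemma form_eq0 C x y : (forall v, form C v = 0) ->
  mon_row x *m C *m (mon_row y)^T = 0.
Proof.
move=> C0.
(* (x, y) = (v, v^* ) + 'i (w, w^* ), so x and y are reached at t = 'i from the
   pairs (v + t w, (v + t w)^* ) with t real. *)
pose v (i : M) : F := 2^-1 * (x i + (y i)^*).
pose w i : F := (2 * 'i)^-1 * (x i - (y i)^*).
pose u t : {ffun M -> F} := [ffun i => v i + t * w i].
pose u' t : {ffun M -> F} := [ffun i => (v i)^* + t * (w i)^*].
pose p := \sum_(b < #|{: X}|) \sum_(a < #|{: X}|) 
  (\prod_j ((v (enum_val a j))%:P + 'X * (w (enum_val a j))%:P)) * (C a b)%:P *
  (\prod_j (((v (enum_val b j))^*)%:P + 'X * ((w (enum_val b j))^*)%:P)).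
have pE t : p.[t] = (mon_row (u t) *m C *m (mon_row (u' t))^T) 0 0.
  rewrite mxE horner_sum; apply: eq_bigr => b _.
  rewrite !mxE mulr_suml horner_sum; apply: eq_bigr => a _.
  rewrite !hornerM !horner_prod hornerC !mxE; congr (_ * _ * _).
    by apply: eq_bigr => j _; rewrite /= hornerD hornerC hornerM hornerX hornerC ffunE.
  by apply: eq_bigr => j _; rewrite /= hornerD hornerC hornerM hornerX hornerC ffunE.
have ix : u 'i = x.
  by apply/ffunP => i; rewrite ffunE /v /w; field; rewrite neq0Ci.
have iy : u' 'i = y.
  apply/ffunP => i; rewrite ffunE /v /w !rmorphM !fmorphV !rmorphM rmorphB !rmorphD.
  by rewrite /= !conjCK conjCi rmorph1; field; rewrite neq0Ci.
apply/matrixP => a b; rewrite !ord1 -ix -iy -pE mxE.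
suff -> : p = 0 by rewrite horner0.
apply: poly_eq0_nat => t; rewrite pE -[RHS](C0 (u t%:R)) /form tr_conj_mon_row.
congr ((_ *m (mon_row _)^T) 0 0); apply/ffunP => i.
by rewrite !ffunE rmorphD rmorphM rmorph_nat.
Qed.

(* This is tensor_act, over an arbitrary closed field. *)
Definition multi_act (u : mxfam) (v : {ffun M -> F}) : {ffun M -> F} :=
  [ffun i : M => \sum_(j : M) (\prod_k u k (i k) (j k)) * v j].

Lemma mon_row_act u v : mon_row (multi_act u v) = mon_row v *m (tens_pow m u)^T.
Proof.
apply/rowP => a; rewrite !mxE.
under eq_bigr do rewrite ffunE.
rewrite (bigA_distr_bigA (fun j (i' : M) =>
  \prod_k u k (enum_val a j k) (i' k) * v i')).
rewrite (reindex (@enum_val X predT)) /=; last exact/onW_bij/enum_val_bij.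
by apply: eq_bigr => b _; rewrite !mxE big_split mulrC.
Qed.

Lemma form_act C u v : form C (multi_act u v) =
  form ((tens_pow m u)^T *m C *m map_mx Num.conj (tens_pow m u)) v.
Proof.
by rewrite /form mon_row_act trmx_mul map_mxM trmxK !mulmxA.
Qed.

Lemma form_sym C v : form (sym_mx *m C *m sym_mx) v = form C v.
Proof.
rewrite /form tr_conj_mon_row !mulmxA mon_row_sym -mulmxA.
by rewrite -{1}tr_sym_mx -trmx_mul mon_row_sym.
Qed.

(** Permuting all m factors at once fixes the m-th power of a vector. This freedom later makes the
    last slot trivial. *)
Lemma form_mul_slot C v s : form (C *m slot_mx F n (const_perm s)) v = form C v.
Proof.
rewrite /form tr_conj_mon_row !mulmxA -[LHS]/((_ *m _ *m _) 0 0) -mulmxA.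
rewrite -[slot_mx F n _]trmxK tr_slot_mx -trmx_mul.
suff -> : (const_perm s)^-1%g = const_perm s^-1%g by rewrite mon_row_slot.
by apply/ffunP => k; rewrite !ffunE.
Qed.

(** The inverse is chosen so that [h] lands on the conjugated factor, as in the definition of
    [f_poly]. *)
Lemma form_slotV h v : form (slot_mx F n h^-1%g) v =
  \sum_(I : X) \prod_j (v (I j) * (v (slot_act h I j))^*).
Proof.
rewrite /form mon_row_mul_slot mxE (reindex (@enum_rank X)) /=; last first.
  exact/onW_bij/enum_rank_bij.
rewrite (reindex_inj (can_inj (slot_actK h))) /=; apply: eq_bigr => I _.
by rewrite !mxE !enum_rankK slot_actK rmorph_prod big_split.
Qed.

Lemma form_linear v : linear (fun C => form C v : F^o).
Proof.
by move=> a C D; rewrite /form mulmxDr mulmxDl -scalemxAr -scalemxAl !mxE.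
Qed.

(** Acting by a unitary family replaces [C] by a matrix [D] with the same form. Both are
    symmetrized, so polarization forces [D = C], which is the commutation after cancelling a unitary
    factor. *)
Lemma invariant_form_commute C :
    (forall u v, (forall k, u k \is unitarymx) ->
       form C (multi_act u v) = form C v) ->
    sym_mx *m C *m sym_mx = C ->
  forall u : mxfam, (forall k, u k \is unitarymx) ->
    C *m tens_pow m u = tens_pow m u *m C.
Proof.
(* Since [form_act] transposes the left factor, acting by the transposes [ut] turns [D] into [C]
   conjugated by [tens_pow m u]. *)
move=> C_inv C_sym u u_unit; pose ut k := (u k)^T.
have ut_unit k : ut k \is unitarymx by rewrite trmx_unitary.
have {C_inv} inv v := C_inv ut v ut_unit.
pose D := (tens_pow m ut)^T *m C *m map_mx Num.conj (tens_pow m ut).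
have Dsym : sym_mx *m D *m sym_mx = D.
  rewrite /D tr_tens_pow map_tens_pow -{2}C_sym !mulmxA -tens_pow_sym.
  by rewrite -[in LHS]mulmxA [X in _ *m X = _]tens_pow_sym !mulmxA.
have DC : D = C.
  apply/eqP; rewrite -subr_eq0 -Dsym -{1}C_sym -mulmxBl -mulmxBr; apply/eqP.
  apply: sym_mx_eq0 => x y; apply: form_eq0 => v.
  have /= e := form_linear v (-1) C D.
  by rewrite addrC -scaleN1r e -form_act inv scaleN1r addNr.
have utu : map_mx Num.conj (tens_pow m ut) *m tens_pow m u = 1%:M.
  rewrite map_tens_pow tens_powM -(tens_pow1 F n m); congr (tens_pow m _).
  apply/functional_extensionality_dep => k.
  have : (u k)^t* *m u k = 1%:M.
    by rewrite -invmx_unitary // mulVmx // unitarymx_unit.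
  by [].
rewrite -[in LHS]DC /D -mulmxA utu mulmx1 tr_tens_pow; congr (tens_pow m _ *m _).
by apply/functional_extensionality_dep => k; rewrite trmxK.
Qed.

(** Slot permutations commute with tensor powers, so the two factors produced by [form_act] become
    adjacent and cancel by unitarity. *)
Lemma form_slot_act h u v : (forall k, u k \is unitarymx) ->
  form (slot_mx F n h) (multi_act u v) = form (slot_mx F n h) v.
Proof.
move=> u_unit; rewrite form_act tr_tens_pow tens_pow_slot -mulmxA map_tens_pow.
rewrite tens_powM.
suff -> : tens_pow m (fun k => (u k)^T *m map_mx Num.conj (u k)) = 1%:M.
  by rewrite mulmx1.
rewrite -(tens_pow1 F n m); congr (tens_pow m _).
apply/functional_extensionality_dep => k.
have : (u k)^T \is unitarymx by rewrite trmx_unitary.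
by move/unitarymxP; rewrite trmxK.
Qed.

End Forms.

(** * Homogeneous polynomial functions *)

Section ComplexSpan.

Variables (R : realType) (T : Type).
Implicit Types (A B : set (T -> R[i])) (f g : T -> R[i]).

Lemma sub_cspan A f : A f -> cspan A f.
Proof.
move=> Af; exists 1, (fun=> 1), (fun=> f); split=> //.
by apply/funext => v; rewrite big_ord1 mul1r.
Qed.

Lemma cspan0 A : cspan A (fun=> 0).
Proof.
exists 0, (fun=> 0), (fun=> fun=> 0); split=> [[]//|].
by apply/funext => v; rewrite big_ord0.
Qed.

Lemma cspanD A f g : cspan A f -> cspan A g -> cspan A (fun v => f v + g v).
Proof.
move=> [N [c [h [Ah ->]]]] [N' [c' [h' [Ah' ->]]]].
exists (N + N')%N, (fun a => match split a with inl b => c b | inr b => c' b end).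
exists (fun a => match split a with inl b => h b | inr b => h' b end); split.
  by move=> a; case: (split a).
apply/funext => v; rewrite big_split_ord; congr (_ + _); apply: eq_bigr => a _.
  by rewrite (unsplitK (inl a)).
by rewrite (unsplitK (inr a)).
Qed.

Lemma cspanZ A (c : R[i]) f : cspan A f -> cspan A (fun v => c * f v).
Proof.
move=> [N [c' [h [Ah ->]]]]; exists N, (fun a => c * c' a), h; split=> //.
by apply/funext => v; rewrite mulr_sumr; apply: eq_bigr => a _; rewrite mulrA.
Qed.

Lemma cspan_sum A (I : Type) (s : seq I) (P : pred I) (h : I -> T -> R[i]) :
  (forall a, P a -> cspan A (h a)) -> cspan A (fun v => \sum_(a <- s | P a) h a v).
Proof.
move=> Ah; elim: s => [|a s IH].
  by under eq_fun => v do rewrite big_nil; exact: cspan0.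
under eq_fun => v do rewrite big_cons; have := Ah a; case: (P a) => // Aha.
by apply: cspanD => //; exact: Aha.
Qed.

Lemma cspanM A B D f g :
    (forall f g, A f -> B g -> D (fun v => f v * g v)) ->
  cspan A f -> cspan B g -> cspan D (fun v => f v * g v).
Proof.
move=> DAB [N [c [h [Ah ->]]]] [N' [c' [h' [Bh' ->]]]].
under eq_fun => v do rewrite mulr_suml; apply: cspan_sum => a _.
under eq_fun => v do rewrite mulr_sumr; apply: cspan_sum => b _.
under eq_fun => v do rewrite mulrACA; apply: cspanZ; apply: sub_cspan; exact: DAB.
Qed.

End ComplexSpan.

Section HomogeneousFunctions.

Variables (R : realType) (r : nat) (n : 'I_r -> nat).

Local Notation M := (multi_index n).

(** Monomials in the x and y are given by two lists of indices: products become concatenations, and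
    the bidegree is the pair of sizes. *)
Definition conj_monomials (d : nat) : set (tensor R n -> R[i]) :=
  [set g | exists s t : seq M, (size s + size t = d)%N /\
     g = fun v : tensor R n =>
       (\prod_(i <- s) v i) * \prod_(i <- t) (v i : R[i])^*].

Lemma conj_monomialsM d d' f g :
  cspan (conj_monomials d) f -> cspan (conj_monomials d') g ->
  cspan (conj_monomials (d + d')) (fun v => f v * g v).
Proof.
apply: cspanM => _ _ [s [t [<- ->]]] [s' [t' [<- ->]]].
exists (s ++ s'), (t ++ t'); rewrite !size_cat addnACA; split=> //.
by apply/funext => v; rewrite !big_cat mulrACA.
Qed.

Lemma conj_monomials1 : cspan (conj_monomials 0) (fun=> 1).
Proof.
apply: sub_cspan; exists [::], [::]; split=> //.
by apply/funext => v; rewrite !big_nil mulr1.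
Qed.

Lemma real_coord_cspan k : cspan (conj_monomials 1) (fun v => real_coord v k).
Proof.
have x_span i : cspan (conj_monomials 1) (fun v => v i : R[i]).
  apply: sub_cspan; exists [:: i], [::]; split=> //.
  by apply/funext => v; rewrite big_nil big_seq1 mulr1.
have y_span i : cspan (conj_monomials 1) (fun v => (v i : R[i])^*).
  apply: sub_cspan; exists [::], [:: i]; split=> //.
  by apply/funext => v; rewrite big_nil big_seq1 mul1r.
rewrite /real_coord; case: (enum_val k) => i.
  under eq_fun => v do rewrite ReE mulrC.
  by apply: cspanZ; apply: cspanD.
under eq_fun => v do rewrite ImE mulrC mulrA -[- v i]mulN1r.
by apply: cspanZ; apply: cspanD => //; apply: cspanZ.
Qed.

(** Real and imaginary parts are linear combinations of x and y, so a real monomial expands into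
    monomials in x and y of the same total degree. *)
Lemma homog_poly_cspan d f :
  @homog_poly_funs R r n d f -> cspan (conj_monomials d) f.
Proof.
move=> [p /dhomogP p_homog ->].
have monE (mu : 'X_{1.. #|{: M + M}|}) (s : seq 'I_#|{: M + M}|) :
    cspan (conj_monomials (\sum_(k <- s) mu k))
      (fun v => \prod_(k <- s) real_coord v k ^+ mu k).
  elim: s => [|k s IH].
    rewrite big_nil; under eq_fun => v do rewrite big_nil; exact: conj_monomials1.
  rewrite big_cons; under [X in cspan _ X]eq_fun => v do rewrite big_cons.
  apply: conj_monomialsM IH; elim: (mu k) => [|e IHe].
    under eq_fun => v do rewrite expr0; exact: conj_monomials1.
  rewrite -add1n; under eq_fun => v do rewrite exprS.
  exact: conj_monomialsM (real_coord_cspan k) IHe.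
under eq_fun => v do rewrite mevalE big_seq.
apply: cspan_sum => mu /p_homog <-; apply: cspanZ; rewrite /= mdegE; exact: monE.
Qed.

Lemma circle_invariant_form (m : nat) (f : tensor R n -> R[i]) (i0 : M) :
    cspan (conj_monomials (2 * m)) f ->
    (forall (z : R[i]) (v : tensor R n), z * z^* = 1 ->
       f [ffun i => z * v i] = f v) ->
  exists C : 'M_#|{: {ffun 'I_m -> M}}|, f = form C.
Proof.
move=> [N [c [h [hW fE]]]] f_circle.
have [s {hW}/choice [t hE]] := choice hW.
(* Comparing powers of z on the unit circle keeps only the terms with as many
   conjugated factors as unconjugated ones. *)
have f_bideg v : f v = \sum_(a < N | size (s a) == m) c a * h a v.
  (* For z on the circle and s + t = 2m, multiplying z^s times the t-th power of the conjugate of z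
     by z^(2m) gives z^(2s); this clears the conjugates of z. *)
  pose p : {poly R[i]} := \sum_(a < N) (c a * h a v)%:P * 'X^(2 * size (s a)) -
    (f v)%:P * 'X^(2 * m).
  have : p = 0.
    apply: poly_eq0_circle => z zz.
    rewrite hornerD hornerN hornerM hornerC hornerXn -(f_circle z v zz) fE.
    rewrite horner_sum mulr_suml; apply/eqP; rewrite subr_eq0; apply/eqP.
    apply: eq_bigr => a _; rewrite hornerM hornerC hornerXn.
    have [st ->] := hE a.
    under [in RHS]eq_bigr => i _ do rewrite ffunE.
    under [X in _ = c a * (_ * X) * _]eq_bigr => i _ do rewrite ffunE rmorphM.
    rewrite !big_split /= !big_const_seq !count_predT !iter_mulr_1.
    have -> : z ^+ (2 * size (s a)) =
        z ^+ size (s a) * z^* ^+ size (t a) * z ^+ (2 * m).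
      rewrite -st exprD [z ^+ size (s a) * z ^+ _]mulrC mulrA.
      rewrite -[X in X * _]mulrA -exprMn [z^* * z]mulrC zz expr1n mulr1.
      by rewrite -exprD addnn mul2n.
    ring.
  move=> /(congr1 (fun q : {poly R[i]} => q`_(2 * m))).
  rewrite coefB coef_sum coefCM coefXn eqxx mulr1 coef0 => /eqP.
  rewrite subr_eq0 => /eqP <-; rewrite [RHS]big_mkcond; apply: eq_bigr => a _.
  rewrite coefCM coefXn eqn_mul2l /= eq_sym.
  by case: eqP => _; rewrite ?mulr1 ?mulr0.
(* [i0] is the default of [nth], out of reach for the lists of size m to which [wE] applies. *)
pose w (u : seq M) : 'I_#|{: {ffun 'I_m -> M}}| :=
  enum_rank [ffun j : 'I_m => nth i0 u j].
have wE (u : seq M) (g : M -> R[i]) : size u = m ->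
    \prod_(i <- u) g i = \prod_j g (enum_val (w u) j).
  move=> um; rewrite (big_nth i0) um big_mkord.
  by apply: eq_bigr => j _; rewrite enum_rankK ffunE.
exists (\sum_(a < N | size (s a) == m) c a *: delta_mx (w (s a)) (w (t a))).
apply/funext => v; rewrite f_bideg /form mulmx_sumr mulmx_suml summxE.
apply: eq_bigr => a /eqP sa; have [sta ->] := hE a.
have ta : size (t a) = m.
  by apply/eqP; rewrite -(eqn_add2l m) -{1}sa sta mul2n addnn.
rewrite -scalemxAr -scalemxAl mxE; congr (_ * _).
rewrite -(mul_delta_mx (0 : 'I_1)) mulmxA -colE -mulmxA -rowE.
by rewrite mxE big_ord1 !mxE rmorph_prod !wE.
Qed.

Lemma f_poly_homog (m : nat) (sigma : {ffun 'I_r.-1 -> 'S_m}) :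
  @homog_poly_funs R r n (2 * m) (f_poly sigma).
Proof.
pose x (i : M) : {mpoly R[i][#|{: M + M}|]} :=
  'X_(enum_rank (inl i : M + M)) + 'i *: 'X_(enum_rank (inr i : M + M)).
pose y (i : M) : {mpoly R[i][#|{: M + M}|]} :=
  'X_(enum_rank (inl i : M + M)) - 'i *: 'X_(enum_rank (inr i : M + M)).
have xE (v : tensor R n) i : (x i).@[real_coord v] = v i.
  by rewrite mevalD mevalZ !mevalXU /real_coord !enum_rankK -Crect.
have yE (v : tensor R n) i : (y i).@[real_coord v] = (v i : R[i])^*.
  rewrite mevalB mevalZ !mevalXU /real_coord !enum_rankK.
  by rewrite {3}[v i]Crect conjC_rect ?Creal_Re ?Creal_Im.
have X_homog k : ('X_k : {mpoly R[i][#|{: M + M}|]}) \is 1.-homog.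
  by rewrite dhomogX /= mdeg1.
have xy_homog i i' : x i * y i' \is 2.-homog.
  by rewrite -[2%N]/(1 + 1)%N; apply: dhomogM; rewrite ?rpredB ?rpredD ?rpredZ.
exists (\sum_(i : {ffun 'I_m -> M}) \prod_j
  (x (i j) * y [ffun k => i (slot_perm sigma k j) k])).
  apply: rpred_sum => i _; rewrite -[X in _ \is X.-homog](mulnC m).
  rewrite -[m in (m * 2)%N]card_ord -sum_nat_const.
  elim/big_rec2: _ => [|j d p _ IH]; first exact: dhomog1.
  exact: dhomogM (xy_homog _ _) IH.
apply/funext => v; rewrite /f_poly raddf_sum; apply: eq_bigr => i _ /=.
by rewrite rmorph_prod; apply: eq_bigr => j _ /=; rewrite mevalM xE yE.
Qed.

End HomogeneousFunctions.

(** * Unitary invariance and the forms of slot permutations *)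

Section Invariants.

Variables (R : realType) (r : nat) (n : 'I_r -> nat).

Local Notation M := (multi_index n).

Lemma invariant_tensor_act (f : tensor R n -> R[i]) u v :
  @invariant_funs R r n f -> (forall k, u k \is unitarymx) ->
  f (tensor_act u v) = f v.
Proof.
move=> f_inv u_unit; have := f_inv (fun k => invmx (u k)); rewrite /fun_act => e.
rewrite -[in RHS]e => [|k]; last by rewrite invmx_unitary ?trmxC_unitary.
congr (f (tensor_act _ v)).
by apply/functional_extensionality_dep => k; rewrite invmxK.
Qed.

Lemma f_polyE (m : nat) (sigma : {ffun 'I_r.-1 -> 'S_m})
    (h : {dffun forall k : 'I_r, 'S_m}) :
    (forall k, h k = slot_perm sigma k) ->
  @f_poly R r n m sigma = form (slot_mx R[i] n h^-1%g).
Proof.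
move=> hE; apply/funext => v; rewrite form_slotV; apply: eq_bigr => i _.
apply: eq_bigr => j _; congr (_ * (v _)^*).
by apply/ffunP => k; rewrite !ffunE hE.
Qed.

Lemma f_poly_invariant (m : nat) (sigma : {ffun 'I_r.-1 -> 'S_m}) :
  @invariant_funs R r n (f_poly sigma).
Proof.
move=> g g_unit; apply/funext => v; rewrite /fun_act.
rewrite (@f_polyE _ _ [ffun k => slot_perm sigma k]) => [|k]; last by rewrite ffunE.
by apply: form_slot_act => k; rewrite invmx_unitary ?trmxC_unitary.
Qed.

(** Scalars of modulus 1 thus act on V through K(n), by scaling in one slot; this is the source of
    circle invariance. *)
Lemma tensor_act_scalar (k0 : 'I_r) (z : R[i]) (v : tensor R n) :
  tensor_act (fun k => if k == k0 then z%:M else 1%:M) v = [ffun i => z * v i].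
Proof.
apply/ffunP => i; rewrite !ffunE (bigD1 i) //= [X in _ + X]big1 => [|j ji].
  rewrite addr0 (bigD1 k0) //= eqxx mxE eqxx big1 ?mulr1 // => k /negbTE ->.
  by rewrite mxE eqxx.
have [k jik] : exists k, j k != i k.
  apply/existsP; rewrite -negb_forall; apply: contra ji => /forallP ij.
  by apply/eqP/ffunP => k; apply/eqP/ij.
rewrite (bigD1 k) //=; case: ifP => _; rewrite mxE eq_sym (negbTE jik);
  by rewrite mulr0n !mul0r.
Qed.

End Invariants.

Lemma form_slot_f_poly (R : realType) (r : nat) (n : 'I_r -> nat) (m : nat)
    (h : {dffun forall k : 'I_r, 'S_m}) :
  (0 < r)%N ->
  exists sigma : {ffun 'I_r.-1 -> 'S_m}, form (slot_mx R[i] n h) = f_poly sigma.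
Proof.
case: r n h => // r' n' h _.
(* A simultaneous permutation of the m factors makes the last slot trivial. *)
pose h' := (h * const_perm r'.+1 (h ord_max)^-1)^-1%g.
pose sigma : {ffun 'I_r' -> 'S_m} := [ffun k => h' (widen_ord (leqnSn r') k)].
exists sigma.
apply/funext => v; rewrite -(form_mul_slot _ _ (h ord_max)^-1%g) -slot_mxM.
rewrite -[X in slot_mx _ _ X]invgK -/h' -(@f_polyE _ r'.+1 _ _ sigma) // => k.
rewrite /slot_perm; case: insubP => [k' _ k'E|].
  by rewrite [RHS]ffunE; have <- : k = widen_ord (leqnSn r') k' by exact: val_inj.
rewrite -leqNgt => kr; have -> : k = ord_max.
  by apply: val_inj; apply/eqP; rewrite eqn_leq kr -ltnS ltn_ord.
by rewrite /h' !ffunE mulgV invg1.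
Qed.

Theorem theorem1 (R : realType) (r : nat) (hr : (1 <= r)%N) (n : 'I_r -> nat)
    (hn : forall k : 'I_r, (0 < n k)%N) (d m : nat) (hd : d = (2 * m)%N) :
  cspan (range (fun sigma : {ffun 'I_r.-1 -> 'S_m} => @f_poly R r n m sigma)) =
  @homog_poly_funs R r n d `&` @invariant_funs R r n.
Proof.
subst d; apply/seteqP; split=> f.
  move=> [N [c [h [hA ->]]]].
  have hA' a : exists s : {ffun _ -> 'S_m}, h a = f_poly s.
    by have [s _ <-] := hA a; exists s.
  have [s sE] := choice hA'; split.
    have pA a : exists p : {mpoly R[i][_]},
        p \is (2 * m).-homog /\
        f_poly (s a) = fun v : tensor R n => p.@[real_coord v].
      by have [p ? ?] := @f_poly_homog R r n m (s a); exists p.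
    have [p pE] := choice pA.
    exists (\sum_a c a *: p a).
      by apply: rpred_sum => a _; apply: rpredZ; have [] := pE a.
    apply/funext => v; rewrite raddf_sum; apply: eq_bigr => a _.
    by have [_ e] := pE a; rewrite sE e /= mevalZ.
  move=> g g_unit; apply/funext => v; apply: eq_bigr => a _; congr (_ * _).
  rewrite sE; have := @f_poly_invariant R r n m (s a) g g_unit.
  by move/(congr1 (fun F => F v)).
move=> [/homog_poly_cspan f_span f_inv].
have f_circle (z : R[i]) (v : tensor R n) :
    z * z^* = 1 -> f [ffun i => z * v i] = f v.
  move=> zz; rewrite -(tensor_act_scalar (Ordinal hr)).
  apply: invariant_tensor_act => // k; apply/unitarymxP.
  case: ifP => _; rewrite tr_scalar_mx map_scalar_mx -scalar_mxM ?zz //.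
  by rewrite mul1r rmorph1.
pose i0 : multi_index n := [ffun k => Ordinal (hn k)].
have [C0 fE] := circle_invariant_form i0 f_span f_circle.
(* Symmetrizing [C0] keeps its form and makes the matrix unique, as [invariant_form_commute]
   needs. *)
pose C := sym_mx R[i] n m *m C0 *m sym_mx R[i] n m.
have {}fE : f = form C by rewrite fE; apply/funext => v; rewrite form_sym.
have C_sym : sym_mx R[i] n m *m C *m sym_mx R[i] n m = C.
  by rewrite /C !mulmxA sym_mxK -mulmxA sym_mxK.
have C_unitary (u : forall k, 'M[R[i]]_(n k)) :
    (forall k, u k \is unitarymx) -> C *m tens_pow m u = tens_pow m u *m C.
  apply: invariant_form_commute C_sym u => u v u_unit; rewrite -fE.
  exact: invariant_tensor_act.
have C_comm := commute_tens_pow_slot (commute_tens_pow C_unitary).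
have nzG : #|{dffun forall k : 'I_r, 'S_m}|%:R != 0 :> R[i].
  by rewrite pnatr_eq0 -lt0n; apply/card_gt0P; exists 1%g.
have [c CE] := double_centralizer nzG (slot_mx1 _ _ _) (@slot_mxM _ _ _ _) C_comm.
(* The expansion of [C] in slot permutations passes to forms by linearity; each term is then some
   [f_poly]. *)
have -> : f = fun v => \sum_g c g * form (slot_mx R[i] n g) v.
  apply/funext => v; rewrite fE CE /form mulmx_sumr mulmx_suml summxE.
  by apply: eq_bigr => g _; rewrite -scalemxAr -scalemxAl mxE.
apply: cspan_sum => g _; apply: cspanZ; apply: sub_cspan.
by have [s ->] := form_slot_f_poly R n g hr; exists s.
Qed.
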